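(* For any formula $A$ of the language of $\mathsf{ILL}_\bot$, one obtains the Gödel-Gentzen translation $A^{\rm G}$ from the outer Kolmogorov translation $A^{{\rm K}_o}$ by systematically applying the following formula reductions, starting from the whole formula and inductively applying them to the subformulas: $$\neg\neg(\neg\neg A\,\&\,\neg\neg B)\mapsto\neg\neg A\,\&\,\neg\neg B,\qquad \neg\neg(\neg\neg A\otimes\neg\neg B)\mapsto\neg\neg A\otimes\neg\neg B,$$ $$\neg\neg(\neg\neg A\multimap\neg\neg B)\mapsto\neg\neg A\multimap\neg\neg B,\qquad \neg\neg\forall x\,\neg\neg A\mapsto\forall x\,\neg\neg A,\qquad \neg\neg\,!\,\neg\neg A\mapsto\,!\,\neg\neg A.$$ Hence $(\cdot)^{\rm G}$ is a simplification from outside of $(\cdot)^{{\rm K}_o}$ (as translations from $\mathsf{CL}_{\rm b}$ to $\mathsf{IL}_\bot$). Moreover, the reductions above are reversible in $\mathsf{IL}_\bot$ (i.e. the two sides of each reduction are provably equivalent in $\mathsf{IL}_\bot$), so $A^{\rm G}$ and $A^{{\rm K}_o}$ are $\mathsf{IL}_\bot$-equivalent.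
   Context: Intuitionistic linear logic $\mathsf{ILL}$ (first order). Formulas are built from atomic formulas, including the constants $1,\top,0$, using $\otimes,\&,\oplus,\multimap$, $\forall x,\exists x$ and $!$. Sequents are $\Gamma\vdash A$ with $\Gamma$ a finite multiset of formulas and exactly one formula on the right. Axioms: $A\vdash A$; $\vdash 1$; $\Gamma\vdash\top$; $\Gamma,0\vdash C$. Rules (premises $\Rightarrow$ conclusion): (cut) $\Gamma\vdash A;\ \Delta,A\vdash C\Rightarrow\Gamma,\Delta\vdash C$; $\Gamma\vdash C\Rightarrow\Gamma,1\vdash C$; $\Gamma\vdash A;\ \Delta\vdash B\Rightarrow\Gamma,\Delta\vdash A\otimes B$; $\Gamma,A,B\vdash C\Rightarrow\Gamma,A\otimes B\vdash C$; $\Gamma,A\vdash B\Rightarrow\Gamma\vdash A\multimap B$; $\Gamma\vdash A;\ \Delta,B\vdash C\Rightarrow\Gamma,\Delta,A\multimap B\vdash C$; $\Gamma\vdash A;\ \Gamma\vdash B\Rightarrow\Gamma\vdash A\& B$; $\Gamma,A\vdash C\Rightarrow\Gamma,A\& B\vdash C$; $\Gamma,B\vdash C\Rightarrow\Gamma,A\& B\vdash C$; $\Gamma\vdash A\Rightarrow\Gamma\vdash A\oplus B$; $\Gamma\vdash B\Rightarrow\Gamma\vdash A\oplus B$; $\Gamma,A\vdash C;\ \Gamma,B\vdash C\Rightarrow\Gamma,A\oplus B\vdash C$; $\Gamma\vdash A\Rightarrow\Gamma\vdash\forall xA$; $\Gamma,A[t/x]\vdash C\Rightarrow\Gamma,\forall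 xA\vdash C$; $\Gamma\vdash A[t/x]\Rightarrow\Gamma\vdash\exists xA$; $\Gamma,A\vdash C\Rightarrow\Gamma,\exists xA\vdash C$ (usual eigenvariable conditions); $\Gamma,!A,!A\vdash C\Rightarrow\Gamma,!A\vdash C$; $\Gamma\vdash C\Rightarrow\Gamma,!A\vdash C$; $!\Gamma\vdash A\Rightarrow\,!\Gamma\vdash\,!A$; $\Gamma,A\vdash C\Rightarrow\Gamma,!A\vdash C$. $\mathsf{ILL}_\bot$ extends $\mathsf{ILL}$ by one more constant $\bot$ (also counted as atomic); its sequents have at most one formula on the right (so $C$ in the rules above may be absent), and it has the additional axiom $\bot\vdash$ and rule $\Gamma\vdash\ \Rightarrow\Gamma\vdash\bot$. $\neg A:=A\multimap\bot$. $\mathsf{PRO}$: $A\vdash\,!A$; $\mathsf{DNE}$: $\neg\neg A\vdash A$ (axiom schemas). $\mathsf{IL}_\bot:=\mathsf{ILL}_\bot+\mathsf{PRO}$; $\mathsf{CL}_{\rm b}:=\mathsf{ILL}_\bot+\mathsf{PRO}+\mathsf{DNE}$. Formulas $A,B$ are equivalent over $S$ if $S$ proves $(A\multimap B)\&(B\multimap A)$. Translations. Throughout $\square\in\{\otimes,\&,\oplus,\multimap\}$, $Q\in\{\forall x,\exists x,!\}$. Outer Kolmogorov: $P^{{\rm K}_o}:=\neg\neg P$ ($P$ atomic), $(A\,\square\,B)^{{\rm K}_o}:=\neg\neg(A^{{\rm K}_o}\,\square\,B^{{\rm K}_o})$, $(QA)^{{\rm K}_o}:=\neg\neg QA^{{\rm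 K}_o}$. Gödel-Gentzen: $P^{\rm G}:=\neg\neg P$ ($P$ atomic); $(A\,\square\,B)^{\rm G}:=A^{\rm G}\,\square\,B^{\rm G}$ for $\square\in\{\otimes,\&,\multimap\}$; $(A\oplus B)^{\rm G}:=\neg\neg(A^{\rm G}\oplus B^{\rm G})$; $(\forall xA)^{\rm G}:=\forall xA^{\rm G}$; $(\exists xA)^{\rm G}:=\neg\neg\exists xA^{\rm G}$; $(!A)^{\rm G}:=\,!A^{\rm G}$. General notions, for a formula construct $T$ (here $T(A)=\neg\neg A$). A $T$-based outer-transform is $\mathcal T_\square(A,B)=T'(A\,\square\,B)$, resp. $\mathcal T_Q(A)=T'(QA)$, with $T'\in\{T,\mathrm{Id}\}$. A modular outer $T$-translation is one given by outer-transforms via $P^{\rm Tr}:=T(P)$ ($P$ atomic), $(A\,\square\,B)^{\rm Tr}:=\mathcal T^{\rm Tr}_\square(A^{\rm Tr},B^{\rm Tr})$, $(QA)^{\rm Tr}:=\mathcal T^{\rm Tr}_Q(A^{\rm Tr})$. A transform is simpler than another one for the same connective, quantifier or modality if the latter uses $T$ in all places where the former does, but not conversely. A translation is sound from $S_1$ to $S_2$ if for all $A$: $\vdash_{S_1}A$ implies $\vdash_{S_2}A^{\rm Tr}$, and $A$, $A^{\rm Tr}$ are equivalent over $S_1$. Two sound translations from $S_1$ to $S_2$ are equivalent if $A^{\rm Tr}$ and $A^{{\rm Tr}'}$ are equivalent over $S_2$ for all $A$. For equivalent translations, ${\rm Tr}'$ is a simplification of ${\rm Tr}$ if each transform of ${\rm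 Tr}'$ is identical to or simpler than the corresponding one of ${\rm Tr}$, and simpler in at least one case. For two equivalent modular outer $T$-translations, ${\rm Tr}'$ is a simplification from outside of ${\rm Tr}$ if it is a simplification of ${\rm Tr}$ and $A^{{\rm Tr}'}$ is obtained from $A^{\rm Tr}$ by applying the reductions $\mathcal T^{\rm Tr}_\square(T(A),T(B))\mapsto\mathcal T^{{\rm Tr}'}_\square(T(A),T(B))$ and $\mathcal T^{\rm Tr}_Q(T(A))\mapsto\mathcal T^{{\rm Tr}'}_Q(T(A))$ recursively, starting from the whole formula and working towards the atomic formulas (at each stage the reduction matching the current formula, if there is one, is applied to it, and one then continues with the parts $T(A)$, $T(B)$ that are the translations of the immediate subformulas). *)

(* Defs.v *)
From Stdlib Require Import List Permutation.
From Stdlib Require Vector.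
Import ListNotations.

Set Implicit Arguments.
Unset Strict Implicit.

Record signature := Signature {
  fun_symbol : Type;
  fun_arity : fun_symbol -> nat;
  pred_symbol : Type;
  pred_arity : pred_symbol -> nat
}.

(** De Bruijn syntax: [Var n] refers to the [n]-th enclosing quantifier, so that
    formulas are taken modulo renaming of bound variables. *)

Inductive term (Sg : signature) : Type :=
| Var (n : nat)
| App (f : fun_symbol Sg) (ts : Vector.t (term Sg) (fun_arity f)).

Arguments Var {Sg} n.

Inductive atom (Sg : signature) : Type :=
| Pred (p : pred_symbol Sg) (ts : Vector.t (term Sg) (pred_arity p))
| One | Top | Zero | Bot.

Arguments One {Sg}.
Arguments Top {Sg}.
Arguments Zero {Sg}.
Arguments Bot {Sg}.

Inductive binop := Tensor | With | Plus | Lolli.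

Inductive unop := All | Ex | Bang.

(** [Un All A] and [Un Ex A] bind variable [0] of [A]; [Un Bang A] binds nothing. *)
Inductive formula (Sg : signature) : Type :=
| Atomic (a : atom Sg)
| Bin (c : binop) (A B : formula Sg)
| Un (q : unop) (A : formula Sg).

Section Calculus.

Context {Sg : signature}.

Local Notation term := (term Sg).
Local Notation atom := (atom Sg).
Local Notation formula := (formula Sg).

Fixpoint tsubst (s : nat -> term) (t : term) : term :=
  match t with
  | Var n => s n
  | App ts => App (Vector.map (tsubst s) ts)
  end.

Definition shift (n : nat) : term := Var (S n).

Definition up (s : nat -> term) (n : nat) : term :=
  match n with
  | 0 => Var 0
  | S m => tsubst shift (s m)
  end.

Definition asubst (s : nat -> term) (a : atom) : atom :=
  match a with
  | Pred ts => Pred (Vector.map (tsubst s) ts)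
  | One => One
  | Top => Top
  | Zero => Zero
  | Bot => Bot
  end.

Fixpoint subst (s : nat -> term) (A : formula) : formula :=
  match A with
  | Atomic a => Atomic (asubst s a)
  | Bin c A B => Bin c (subst s A) (subst s B)
  | Un Bang A => Un Bang (subst s A)
  | Un q A => Un q (subst (up s) A)
  end.

Definition lift (A : formula) : formula := subst shift A.

(** [inst t A] is A[t/x], where x is variable [0] of [A]; the other free
    variables are lowered by one. *)
Definition inst (t : term) (A : formula) : formula :=
  subst (fun n => match n with 0 => t | S m => Var m end) A.

Definition neg (A : formula) : formula := Bin Lolli A (Atomic Bot).

Definition nn (A : formula) : formula := neg (neg A).

(** A system is ILL with bottom together with the additional axioms
    A |- B for all A, B such that [Ax A B]. *)
Definition system := formula -> formula -> Prop.

(** Contexts are lists with an explicit exchange rule, i.e. multisets.  The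
    succedent is [None] when there is no formula on the right.  The eigenvariable
    conditions of [d_all_r] and [d_ex_l] are expressed by lifting the rest of the
    sequent, in which variable [0] then does not occur. *)
Inductive derivable (Ax : system) : list formula -> option formula -> Prop :=
| d_exchange G D C :
    Permutation G D -> derivable Ax G C -> derivable Ax D C
| d_axiom A B :
    Ax A B -> derivable Ax [A] (Some B)
| d_id A :
    derivable Ax [A] (Some A)
| d_cut G D A C :
    derivable Ax G (Some A) -> derivable Ax (A :: D) C -> derivable Ax (G ++ D) C
| d_one_r :
    derivable Ax [] (Some (Atomic One))
| d_one_l G C :
    derivable Ax G C -> derivable Ax (Atomic One :: G) C
| d_top_r G :
    derivable Ax G (Some (Atomic Top))
| d_zero_l G C :
    derivable Ax (Atomic Zero :: G) C
| d_bot_l :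
    derivable Ax [Atomic Bot] None
| d_bot_r G :
    derivable Ax G None -> derivable Ax G (Some (Atomic Bot))
| d_tensor_r G D A B :
    derivable Ax G (Some A) -> derivable Ax D (Some B) ->
    derivable Ax (G ++ D) (Some (Bin Tensor A B))
| d_tensor_l G A B C :
    derivable Ax (A :: B :: G) C -> derivable Ax (Bin Tensor A B :: G) C
| d_lolli_r G A B :
    derivable Ax (A :: G) (Some B) -> derivable Ax G (Some (Bin Lolli A B))
| d_lolli_l G D A B C :
    derivable Ax G (Some A) -> derivable Ax (B :: D) C ->
    derivable Ax (Bin Lolli A B :: G ++ D) C
| d_with_r G A B :
    derivable Ax G (Some A) -> derivable Ax G (Some B) ->
    derivable Ax G (Some (Bin With A B))
| d_with_l1 G A B C :
    derivable Ax (A :: G) C -> derivable Ax (Bin With A B :: G) C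
| d_with_l2 G A B C :
    derivable Ax (B :: G) C -> derivable Ax (Bin With A B :: G) C
| d_plus_r1 G A B :
    derivable Ax G (Some A) -> derivable Ax G (Some (Bin Plus A B))
| d_plus_r2 G A B :
    derivable Ax G (Some B) -> derivable Ax G (Some (Bin Plus A B))
| d_plus_l G A B C :
    derivable Ax (A :: G) C -> derivable Ax (B :: G) C ->
    derivable Ax (Bin Plus A B :: G) C
| d_all_r G A :
    derivable Ax (map lift G) (Some A) -> derivable Ax G (Some (Un All A))
| d_all_l G A t C :
    derivable Ax (inst t A :: G) C -> derivable Ax (Un All A :: G) C
| d_ex_r G A t :
    derivable Ax G (Some (inst t A)) -> derivable Ax G (Some (Un Ex A))
| d_ex_l G A C :
    derivable Ax (A :: map lift G) (option_map lift C) ->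
    derivable Ax (Un Ex A :: G) C
| d_bang_contraction G A C :
    derivable Ax (Un Bang A :: Un Bang A :: G) C -> derivable Ax (Un Bang A :: G) C
| d_bang_weakening G A C :
    derivable Ax G C -> derivable Ax (Un Bang A :: G) C
| d_bang_r G A :
    derivable Ax (map (Un Bang) G) (Some A) ->
    derivable Ax (map (Un Bang) G) (Some (Un Bang A))
| d_bang_l G A C :
    derivable Ax (A :: G) C -> derivable Ax (Un Bang A :: G) C.

Definition provable (Ax : system) (A : formula) : Prop := derivable Ax [] (Some A).

Definition PRO : system := fun A B => B = Un Bang A.

Definition DNE : system := fun A B => A = nn B.

Definition IL_bot : system := PRO.

Definition CL_b : system := fun A B => PRO A B \/ DNE A B.

Definition equivalent (Ax : system) (A B : formula) : Prop :=
  provable Ax (Bin With (Bin Lolli A B) (Bin Lolli B A)).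

Fixpoint Ko (A : formula) : formula :=
  match A with
  | Atomic a => nn (Atomic a)
  | Bin c A B => nn (Bin c (Ko A) (Ko B))
  | Un q A => nn (Un q (Ko A))
  end.

Fixpoint GG (A : formula) : formula :=
  match A with
  | Atomic a => nn (Atomic a)
  | Bin Plus A B => nn (Bin Plus (GG A) (GG B))
  | Bin c A B => Bin c (GG A) (GG B)
  | Un Ex A => nn (Un Ex (GG A))
  | Un q A => Un q (GG A)
  end.

Inductive GG_reduction : formula -> formula -> Prop :=
| red_with A B :
    GG_reduction (nn (Bin With (nn A) (nn B))) (Bin With (nn A) (nn B))
| red_tensor A B :
    GG_reduction (nn (Bin Tensor (nn A) (nn B))) (Bin Tensor (nn A) (nn B))
| red_lolli A B :
    GG_reduction (nn (Bin Lolli (nn A) (nn B))) (Bin Lolli (nn A) (nn B))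
| red_all A :
    GG_reduction (nn (Un All (nn A))) (Un All (nn A))
| red_bang A :
    GG_reduction (nn (Un Bang (nn A))) (Un Bang (nn A)).

Definition sound (S1 S2 : system) (Tr : formula -> formula) : Prop :=
  (forall A, provable S1 A -> provable S2 (Tr A)) /\
  (forall A, equivalent S1 A (Tr A)).

Definition equivalent_translations (S1 S2 : system) (Tr Tr' : formula -> formula) : Prop :=
  sound S1 S2 Tr /\ sound S1 S2 Tr' /\ (forall A, equivalent S2 (Tr A) (Tr' A)).

(** The operator T' of an outer-transform T'(A [] B) or T'(QA). *)
Inductive outer := UseT | UseId.

Definition apply_outer (T : formula -> formula) (o : outer) (A : formula) : formula :=
  match o with
  | UseT => T A
  | UseId => A
  end.

Record transforms := Transforms {
  bin_outer : binop -> outer;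
  un_outer : unop -> outer
}.

Definition bin_transform (T : formula -> formula) (t : transforms) (c : binop)
    (A B : formula) : formula :=
  apply_outer T (bin_outer t c) (Bin c A B).

Definition un_transform (T : formula -> formula) (t : transforms) (q : unop)
    (A : formula) : formula :=
  apply_outer T (un_outer t q) (Un q A).

Definition modular_outer (T : formula -> formula) (t : transforms)
    (Tr : formula -> formula) : Prop :=
  (forall a, Tr (Atomic a) = T (Atomic a)) /\
  (forall c A B, Tr (Bin c A B) = bin_transform T t c (Tr A) (Tr B)) /\
  (forall q A, Tr (Un q A) = un_transform T t q (Tr A)).

Definition simpler (o' o : outer) : Prop :=
  (o' = UseT -> o = UseT) /\ ~ (o = UseT -> o' = UseT).

Definition simpler_transforms (t t' : transforms) : Prop :=
  (forall c, bin_outer t' c = bin_outer t c \/ simpler (bin_outer t' c) (bin_outer t c)) /\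
  (forall q, un_outer t' q = un_outer t q \/ simpler (un_outer t' q) (un_outer t q)) /\
  ((exists c, simpler (bin_outer t' c) (bin_outer t c)) \/
   (exists q, simpler (un_outer t' q) (un_outer t q))).

Inductive transform_reduction (T : formula -> formula) (t t' : transforms) :
    formula -> formula -> Prop :=
| tred_bin c A B :
    transform_reduction T t t'
      (bin_transform T t c (T A) (T B)) (bin_transform T t' c (T A) (T B))
| tred_un q A :
    transform_reduction T t t'
      (un_transform T t q (T A)) (un_transform T t' q (T A)).

Definition head_step (R : formula -> formula -> Prop) (F F' : formula) : Prop :=
  R F F' \/ (F' = F /\ forall F'', ~ R F F'').

(** [outside_in T R Tr A F]: applying the reductions [R] to [Tr A] from the
    outside towards the atomic formulas results in [F].  The current formula is the
    translation of a subformula of the initial formula.  After the step at its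
    root it has the form T'(A^Tr [] B^Tr) or T'(Q A^Tr), and the process continues
    inside, at A^Tr and B^Tr. *)
Inductive outside_in (T : formula -> formula) (R : formula -> formula -> Prop)
    (Tr : formula -> formula) : formula -> formula -> Prop :=
| oi_atomic a :
    outside_in T R Tr (Atomic a) (Tr (Atomic a))
| oi_bin c A B o F1 F2 :
    head_step R (Tr (Bin c A B)) (apply_outer T o (Bin c (Tr A) (Tr B))) ->
    outside_in T R Tr A F1 -> outside_in T R Tr B F2 ->
    outside_in T R Tr (Bin c A B) (apply_outer T o (Bin c F1 F2))
| oi_un q A o F :
    head_step R (Tr (Un q A)) (apply_outer T o (Un q (Tr A))) ->
    outside_in T R Tr A F ->
    outside_in T R Tr (Un q A) (apply_outer T o (Un q F)).

(** [Tr'] (with transforms [t']) is a simplification from outside of [Tr] (with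
    transforms [t]), as [T]-translations from [S1] to [S2]. *)
Definition simplification_from_outside (T : formula -> formula) (S1 S2 : system)
    (t : transforms) (Tr : formula -> formula)
    (t' : transforms) (Tr' : formula -> formula) : Prop :=
  modular_outer T t Tr /\
  modular_outer T t' Tr' /\
  equivalent_translations S1 S2 Tr Tr' /\
  simpler_transforms t t' /\
  (forall A, outside_in T (transform_reduction T t t') Tr A (Tr' A)).

End Calculus.

Definition Ko_transforms : transforms :=
  Transforms (fun _ => UseT) (fun _ => UseT).

Definition GG_transforms : transforms :=
  Transforms
    (fun c => match c with Plus => UseT | _ => UseId end)
    (fun q => match q with Ex => UseT | _ => UseId end).

(* Main.v *)
(** In the presence of [A |- !A] every formula can be weakened and contracted, so
    that [IL_bot] behaves like intuitionistic natural deduction over a minimal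
    [Bot].  Each reduction then only removes a double negation in front of a formula
    that is already stable.  By congruence [GG A] and [Ko A] are equivalent
    in [IL_bot], and the soundness of [GG] is inherited from that of [Ko].  The
    latter holds rule by rule, because all succedents [Ko C] are double negations
    and therefore allow double negations to be removed on the left. *)

From Stdlib Require Import List Permutation.
Require Import Defs.
Import ListNotations.

Set Implicit Arguments.
Unset Strict Implicit.

(** * Substitutions, and their commutation with [Ko] *)

Lemma tsubst_cancel (Sg : signature) (r s : nat -> term Sg) :
  (forall n, tsubst s (r n) = Var n) -> forall t, tsubst s (tsubst r t) = t.
Proof.
  (* Terms recur through the argument vectors, so the recursion is set up by hand, with an inner
     induction on the vector. *)
  intros H. fix IH 1. intros [n | f ts]; simpl.
  - apply H.
  - f_equal. induction ts as [| t k ts IHts]; simpl; f_equal; auto.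
Qed.

Lemma asubst_cancel (Sg : signature) (r s : nat -> term Sg) :
  (forall n, tsubst s (r n) = Var n) -> forall a, asubst s (asubst r a) = a.
Proof.
  intros H [p ts | | | |]; simpl; try reflexivity.
  f_equal. induction ts as [| t k ts IHts]; simpl; f_equal; auto using tsubst_cancel.
Qed.

(** Restricting [r] to renamings makes the hypothesis stable under [up] without
    any composition lemma for substitutions. *)
Lemma subst_cancel (Sg : signature) (A : formula Sg) (r s : nat -> term Sg) :
  (forall n, exists k, r n = Var k /\ s k = Var n) -> subst s (subst r A) = A.
Proof.
  revert r s. induction A as [a | c A IHA B IHB | q A IHA]; intros r s H; simpl.
  - f_equal. apply asubst_cancel. intros n. destruct (H n) as (k & -> & E). exact E.
  - rewrite IHA, IHB by exact H. reflexivity.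
  - assert (Hup : forall n, exists k, up r n = Var k /\ up s k = Var n).
    { intros [| n]; simpl.
      - exists 0. split; reflexivity.
      - destruct (H n) as (k & E & E'). exists (S k). rewrite E. simpl.
        rewrite E'. split; reflexivity. }
    destruct q; simpl; rewrite IHA; auto.
Qed.

(** Lifting a quantified hypothesis turns its body into [subst (up shift) A]; instantiating that
    body with the eigenvariable [Var 0] undoes the lifting. *)
Lemma inst_up_shift (Sg : signature) (A : formula Sg) :
  inst (Var 0) (subst (up shift) A) = A.
Proof.
  apply subst_cancel. intros [| n]; eexists; split; reflexivity.
Qed.

Lemma Ko_subst (Sg : signature) (A : formula Sg) (s : nat -> term Sg) :
  Ko (subst s A) = subst s (Ko A).
Proof.
  revert s. induction A as [a | c A IHA B IHB | q A IHA]; intros s; simpl.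
  - reflexivity.
  - rewrite IHA, IHB. reflexivity.
  - destruct q; simpl; rewrite IHA; reflexivity.
Qed.

Lemma map_Ko_lift (Sg : signature) (G : list (formula Sg)) :
  map Ko (map lift G) = map lift (map Ko G).
Proof.
  rewrite !map_map. apply map_ext. intros A. apply Ko_subst.
Qed.

Lemma option_map_Ko_lift (Sg : signature) (C : option (formula Sg)) :
  option_map Ko (option_map lift C) = option_map lift (option_map Ko C).
Proof.
  destruct C as [C |]; simpl; [| reflexivity]. f_equal. apply Ko_subst.
Qed.

(** Exposes the double negation needed for a reduction to match, or for a left double negation to be
    removable. *)
Lemma Ko_nn (Sg : signature) (A : formula Sg) : exists D, Ko A = nn D.
Proof.
  destruct A; eexists; reflexivity.
Qed.

(** * Structural rules for arbitrary formulas, from promotion *)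

Section Promotion.

Context {Sg : signature}.
Variable Ax : system (Sg := Sg).
Hypothesis Ax_PRO : forall A B, PRO A B -> Ax A B.

Local Notation "G |- C" := (derivable Ax G C) (at level 70).

Lemma promote A : [A] |- Some (Un Bang A).
Proof.
  apply d_axiom, Ax_PRO. reflexivity.
Qed.

Lemma weakening A G C : G |- C -> A :: G |- C.
Proof.
  intros H. apply (d_cut (promote A)). apply d_bang_weakening. exact H.
Qed.

Lemma contraction A G C : A :: A :: G |- C -> A :: G |- C.
Proof.
  intros H. apply (d_cut (promote A)). apply d_bang_contraction, d_bang_l.
  eapply d_exchange; [apply perm_swap |]. apply d_bang_l. exact H.
Qed.

Lemma contraction_in A G C : In A G -> A :: G |- C -> G |- C.
Proof.
  intros HA H. destruct (in_split A G HA) as (G1 & G2 & ->).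
  apply d_exchange with (A :: G1 ++ G2); [apply Permutation_middle |].
  apply contraction. revert H. apply d_exchange.
  apply perm_skip, Permutation_sym, Permutation_middle.
Qed.

Lemma weakening_incl G D C : incl G D -> G |- C -> D |- C.
Proof.
  intros HGD H.
  (* All of [D] is first added by weakening; then the members of [G] are contracted one by one into
     their occurrences in [D]. *)
  assert (HDG : D ++ G |- C).
  { clear HGD. induction D as [| A D IH]; [exact H |]. apply weakening, IH. }
  apply (d_exchange (Permutation_app_comm D G)) in HDG. clear H.
  induction G as [| A G IH]; [exact HDG |].
  destruct (incl_cons_inv HGD) as [HA HG]. apply IH; [exact HG |].
  apply contraction_in with A; [| exact HDG]. apply in_or_app. right. exact HA.
Qed.

Lemma weakening_cons_cons A B G C : A :: G |- C -> A :: B :: G |- C.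
Proof.
  apply weakening_incl. apply incl_cons; [now left |].
  apply incl_tl, incl_tl, incl_refl.
Qed.

Lemma hypothesis_in A G : In A G -> G |- Some A.
Proof.
  intros H. apply weakening_incl with [A]; [| apply d_id].
  apply incl_cons; [exact H | apply incl_nil_l].
Qed.

Lemma cut_shared A G C : G |- Some A -> A :: G |- C -> G |- C.
Proof.
  intros H1 H2. apply weakening_incl with (G ++ G); [| exact (d_cut H1 H2)].
  apply incl_app; apply incl_refl.
Qed.

Lemma modus_ponens A B G : G |- Some (Bin Lolli A B) -> G |- Some A -> G |- Some B.
Proof.
  intros H1 H2. apply (cut_shared H1). apply weakening_incl with (Bin Lolli A B :: G ++ []).
  - rewrite app_nil_r. apply incl_refl.
  - apply (d_lolli_l H2), d_id.
Qed.

Lemma bot_elim G : G |- Some (Atomic Bot) -> G |- None.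
Proof.
  intros H. rewrite <- (app_nil_r G). apply (d_cut H), d_bot_l.
Qed.

(** * Double negations on the right and on the left *)

Lemma nn_intro A G : G |- Some A -> G |- Some (nn A).
Proof.
  intros H. apply d_lolli_r. apply modus_ponens with A.
  - apply hypothesis_in. now left.
  - apply weakening, H.
Qed.

Lemma nn_left_bot A G : A :: G |- Some (Atomic Bot) -> nn A :: G |- Some (Atomic Bot).
Proof.
  intros H. apply modus_ponens with (neg A).
  - apply hypothesis_in. now left.
  - apply d_lolli_r, weakening_cons_cons, H.
Qed.

Lemma nn_left_none A G : A :: G |- None -> nn A :: G |- None.
Proof.
  intros H. apply bot_elim, nn_left_bot, d_bot_r, H.
Qed.

Lemma neg_elim A G : G |- Some (neg A) -> A :: G |- Some (Atomic Bot).
Proof.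
  intros H. apply modus_ponens with A.
  - apply weakening, H.
  - apply hypothesis_in. now left.
Qed.

(** Moving [neg D] to the left leaves the succedent [Bot], against which [nn A] can be used. *)
Lemma nn_left_nn A D G : A :: G |- Some (nn D) -> nn A :: G |- Some (nn D).
Proof.
  intros H. apply d_lolli_r.
  apply d_exchange with (nn A :: neg D :: G); [apply perm_swap |].
  apply nn_left_bot. eapply d_exchange; [apply perm_swap |]. apply neg_elim, H.
Qed.

Lemma nn_bot_elim G : G |- Some (nn (Atomic Bot)) -> G |- Some (Atomic Bot).
Proof.
  intros H. apply (cut_shared H), nn_left_bot, hypothesis_in. now left.
Qed.

(** Prepares every left rule: the succedent is a double negation or empty, so the outer double
    negation of the translated principal formula can be stripped. *)
Lemma nn_left_Ko A G C :
  A :: G |- option_map Ko C -> nn A :: G |- option_map Ko C.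
Proof.
  destruct C as [C |]; simpl.
  - destruct (Ko_nn C) as [D ->]. apply nn_left_nn.
  - apply nn_left_none.
Qed.

(** * Provable equivalence as a congruence *)

Lemma equivalent_iff A B :
  equivalent Ax A B <-> [A] |- Some B /\ [B] |- Some A.
Proof.
  split.
  - intros H. split; [apply modus_ponens with A | apply modus_ponens with B];
      try apply d_id; apply weakening, (cut_shared H).
    + apply d_with_l1, d_id.
    + apply d_with_l2, d_id.
  - intros [H1 H2]. apply d_with_r; apply d_lolli_r; assumption.
Qed.

Lemma equivalent_refl A : equivalent Ax A A.
Proof.
  apply equivalent_iff. split; apply d_id.
Qed.

Lemma equivalent_sym A B : equivalent Ax A B -> equivalent Ax B A.
Proof.
  rewrite !equivalent_iff. tauto.
Qed.

Lemma equivalent_trans A B C :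
  equivalent Ax A B -> equivalent Ax B C -> equivalent Ax A C.
Proof.
  rewrite !equivalent_iff. intros [H1 H2] [H3 H4]. split.
  - exact (d_cut H1 H3).
  - exact (d_cut H4 H2).
Qed.

Lemma entails_cons A B G : [A] |- Some B -> A :: G |- Some B.
Proof.
  apply weakening_incl. apply incl_cons; [now left | apply incl_nil_l].
Qed.

Lemma equivalent_bin c A A' B B' :
  equivalent Ax A A' -> equivalent Ax B B' ->
  equivalent Ax (Bin c A B) (Bin c A' B').
Proof.
  (* The converse entailment from [A'] to [A] serves the contravariant side of [Lolli]. *)
  assert (mono : forall A A' B B', [A] |- Some A' -> [A'] |- Some A ->
    [B] |- Some B' -> [Bin c A B] |- Some (Bin c A' B')).
  { clear. intros A A' B B' HA HA' HB. destruct c.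
    - apply d_tensor_l. exact (d_tensor_r HA HB).
    - apply d_with_r; [apply d_with_l1 | apply d_with_l2]; assumption.
    - apply d_plus_l; [apply d_plus_r1 | apply d_plus_r2]; assumption.
    - apply d_lolli_r. eapply d_exchange; [apply perm_swap |].
      exact (d_lolli_l HA' HB). }
  rewrite !equivalent_iff. intros [] []. split; apply mono; assumption.
Qed.

Lemma entails_all A B G : [A] |- Some B -> Un All A :: G |- Some (Un All B).
Proof.
  intros H. apply d_all_r. simpl. apply d_all_l with (Var 0).
  rewrite inst_up_shift. apply entails_cons, H.
Qed.

Lemma entails_ex A B : [A] |- Some B -> [Un Ex A] |- Some (Un Ex B).
Proof.
  intros H. apply d_ex_l. simpl. apply d_ex_r with (Var 0).
  rewrite inst_up_shift. exact H.
Qed.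

Lemma entails_bang A B : [A] |- Some B -> [Un Bang A] |- Some (Un Bang B).
Proof.
  intros H. apply (d_bang_r (G := [A])), d_bang_l, H.
Qed.

Lemma equivalent_un q A A' :
  equivalent Ax A A' -> equivalent Ax (Un q A) (Un q A').
Proof.
  rewrite !equivalent_iff. intros [].
  destruct q; split; auto using entails_all, entails_ex, entails_bang.
Qed.

Lemma equivalent_nn A A' : equivalent Ax A A' -> equivalent Ax (nn A) (nn A').
Proof.
  intros H. apply equivalent_bin; [| apply equivalent_refl].
  apply equivalent_bin; [exact H | apply equivalent_refl].
Qed.

(** * Reversibility of the reductions and equivalence of [GG] and [Ko] *)

Lemma GG_reduction_reversible F F' : GG_reduction F F' -> equivalent Ax F F'.
Proof.
  intros H. apply equivalent_iff.
  destruct H as [A B | A B | A B | A | A];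
    (split; [| apply nn_intro, d_id]).
  - apply d_with_r; apply nn_left_nn; [apply d_with_l1 | apply d_with_l2]; apply d_id.
  (* The hypothesis is duplicated, and each copy supplies one factor. *)
  - apply contraction. apply (d_tensor_r (G := [_]) (D := [_])); apply nn_left_nn, d_tensor_l;
      apply hypothesis_in; simpl; auto.
  - apply d_lolli_r. eapply d_exchange; [apply perm_swap |]. apply nn_left_nn.
    apply modus_ponens with (nn A); apply hypothesis_in; simpl; auto.
  - apply d_all_r. simpl. apply (@nn_left_nn (Un All _)).
    apply d_all_l with (Var 0). simpl.
    change (derivable Ax [inst (Var 0) (subst (up shift) (nn A))] (Some (nn A))).
    rewrite inst_up_shift. apply d_id.
  (* The goal is not itself a double negation: [nn A] is derived first and then promoted. *)
  - refine (cut_shared _ (entails_cons _ (promote _))). apply nn_left_nn, d_bang_l, d_id.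
Qed.

Lemma GG_equivalent_Ko A : equivalent Ax (GG A) (Ko A).
Proof.
  induction A as [a | c A IHA B IHB | q A IHA].
  - apply equivalent_refl.
  - assert (H : equivalent Ax (Bin c (GG A) (GG B)) (Bin c (Ko A) (Ko B))).
    { apply equivalent_bin; assumption. }
    (* For [Plus] both translations keep the double negation; for the other connectives a reversed
       reduction restores it. *)
    destruct c; simpl; [| | apply equivalent_nn, H |];
      apply (equivalent_trans H), equivalent_sym, GG_reduction_reversible;
      destruct (Ko_nn A) as [A' ->], (Ko_nn B) as [B' ->]; constructor.
  - assert (H : equivalent Ax (Un q (GG A)) (Un q (Ko A))).
    { apply equivalent_un, IHA. }
    destruct q; simpl; [| apply equivalent_nn, H |];
      apply (equivalent_trans H), equivalent_sym, GG_reduction_reversible;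
      destruct (Ko_nn A) as [A' ->]; constructor.
Qed.

(** * Soundness of [Ko] and [GG] *)

Lemma equivalent_Ko A :
  (forall B C, DNE B C -> Ax B C) -> equivalent Ax A (Ko A).
Proof.
  intros Ax_DNE.
  (* Each double negation inserted by [Ko] is harmless once all formulas are stable. *)
  assert (stable : forall B, equivalent Ax B (nn B)).
  { intros B. apply equivalent_iff. split.
    - apply nn_intro, d_id.
    - apply d_axiom, Ax_DNE. reflexivity. }
  induction A as [a | c A IHA B IHB | q A IHA]; simpl.
  - apply stable.
  - eapply equivalent_trans; [apply equivalent_bin; eassumption | apply stable].
  - eapply equivalent_trans; [apply equivalent_un; eassumption | apply stable].
Qed.

(** [Ko] turns the inner [Bot]s into [nn (Atomic Bot)]. With [Ko B = nn D], the assumption [neg D]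
    refutes [Ko B], so the hypothesis yields [nn (Atomic Bot)], which collapses to [Bot]. *)
Lemma Ko_DNE B : [Ko (nn B)] |- Some (Ko B).
Proof.
  simpl. destruct (Ko_nn B) as [D ->]. apply nn_left_nn, d_lolli_r.
  apply nn_bot_elim. eapply modus_ponens.
  - apply hypothesis_in. right. left. reflexivity.
  - apply nn_intro, d_lolli_r, nn_intro.
    apply modus_ponens with (neg D); apply hypothesis_in; simpl; auto.
Qed.

Lemma Ko_derivable G C :
  derivable CL_b G C -> map Ko G |- option_map Ko C.
Proof.
  intros H.
  induction H as
    [ G D C HGD _ IH | A B HAB | A | G D A C _ IH1 _ IH2 | | G C _ IH | G | G C
    | | G _ IH | G D A B _ IH1 _ IH2 | G A B C _ IH | G A B _ IH
    | G D A B C _ IH1 _ IH2 | G A B _ IH1 _ IH2 | G A B C _ IH | G A B C _ IH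
    | G A B _ IH | G A B _ IH | G A B C _ IH1 _ IH2 | G A _ IH | G A t C _ IH
    | G A t _ IH | G A C _ IH | G A C _ IH | G A C _ IH | G A _ IH | G A C _ IH ];
    simpl in *; rewrite ?map_app.
  - exact (d_exchange (Permutation_map Ko HGD) IH).
  - destruct HAB as [-> | ->].
    + apply nn_intro, promote.
    + apply Ko_DNE.
  - apply d_id.
  - exact (d_cut IH1 IH2).
  - apply nn_intro, d_one_r.
  - apply weakening, IH.
  - apply nn_intro, d_top_r.
  - apply nn_left_Ko, d_zero_l.
  - apply nn_left_none, d_bot_l.
  - apply nn_intro, d_bot_r, IH.
  - apply nn_intro, d_tensor_r; assumption.
  - apply nn_left_Ko, d_tensor_l, IH.
  - apply nn_intro, d_lolli_r, IH.
  - apply nn_left_Ko, d_lolli_l; assumption.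
  - apply nn_intro, d_with_r; assumption.
  - apply nn_left_Ko, d_with_l1, IH.
  - apply nn_left_Ko, d_with_l2, IH.
  - apply nn_intro, d_plus_r1, IH.
  - apply nn_intro, d_plus_r2, IH.
  - apply nn_left_Ko, d_plus_l; assumption.
  - apply nn_intro, d_all_r. rewrite <- map_Ko_lift. exact IH.
  - apply nn_left_Ko, d_all_l with t. unfold inst in *. rewrite <- Ko_subst. exact IH.
  - apply nn_intro, d_ex_r with t. unfold inst in *. rewrite <- Ko_subst. exact IH.
  - apply nn_left_Ko, d_ex_l.
    rewrite <- map_Ko_lift, <- option_map_Ko_lift. exact IH.
  (* A translated [!] formula begins with a double negation, so the derived structural rules are
     used. *)
  - apply contraction, IH.
  - apply weakening, IH.
  (* For the same reason [d_bang_r] does not fit the translated context; the axiom [PRO] introduces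
     the [!] instead. *)
  - apply nn_intro. rewrite <- (app_nil_r (map Ko _)). exact (d_cut IH (promote _)).
  - apply nn_left_Ko, d_bang_l, IH.
Qed.

End Promotion.

Lemma CL_b_PRO (Sg : signature) (A B : formula Sg) : PRO A B -> CL_b A B.
Proof.
  left. assumption.
Qed.

Lemma sound_Ko (Sg : signature) : sound (Sg := Sg) CL_b IL_bot Ko.
Proof.
  split; intros A.
  - intros H. exact (Ko_derivable (fun _ _ HP => HP) H).
  - apply (equivalent_Ko (@CL_b_PRO Sg)). intros B C HBC. right. exact HBC.
Qed.

Lemma sound_GG (Sg : signature) : sound (Sg := Sg) CL_b IL_bot GG.
Proof.
  destruct (sound_Ko Sg) as [Hp He]. split; intros A.
  - intros H. apply (cut_shared (fun _ _ HP => HP) (Hp A H)).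
    exact (proj2 (proj1 (equivalent_iff (fun _ _ HP => HP) _ _)
      (GG_equivalent_Ko (fun _ _ HP => HP) A))).
  (* The equivalence of [GG] and [Ko] is taken over [CL_b] here, which also contains [PRO]. *)
  - apply (equivalent_trans (@CL_b_PRO Sg) (He A)).
    apply (equivalent_sym (@CL_b_PRO Sg)), (GG_equivalent_Ko (@CL_b_PRO Sg)).
Qed.

(** * The reduction process from the outside *)

Lemma modular_outer_Ko (Sg : signature) : modular_outer (Sg := Sg) nn Ko_transforms Ko.
Proof.
  repeat split.
Qed.

Lemma modular_outer_GG (Sg : signature) : modular_outer (Sg := Sg) nn GG_transforms GG.
Proof.
  split; [| split].
  - reflexivity.
  - intros [] A B; reflexivity.
  - intros [] A; reflexivity.
Qed.

(** The head step is forced: a reduction matches for every connective except [Plus], and a matching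
    reduction may not be skipped. *)
Lemma head_step_bin (Sg : signature) c o (A B : formula Sg) :
  head_step GG_reduction (Ko (Bin c A B)) (apply_outer nn o (Bin c (Ko A) (Ko B))) <->
  o = bin_outer GG_transforms c.
Proof.
  simpl. destruct (Ko_nn A) as [A' ->], (Ko_nn B) as [B' ->]. split.
  - intros [H | [E H]].
    + destruct c, o; simpl in *; try reflexivity; exfalso; inversion H.
    + destruct c, o; simpl in *; try reflexivity; exfalso;
        try discriminate; eapply H; constructor.
  - intros ->. destruct c; simpl; try (left; constructor; fail).
    right. split; [reflexivity |]. intros F'' H. inversion H.
Qed.

Lemma head_step_un (Sg : signature) q o (A : formula Sg) :
  head_step GG_reduction (Ko (Un q A)) (apply_outer nn o (Un q (Ko A))) <->
  o = un_outer GG_transforms q.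
Proof.
  simpl. destruct (Ko_nn A) as [A' ->]. split.
  - intros [H | [E H]].
    + destruct q, o; simpl in *; try reflexivity; exfalso; inversion H.
    + destruct q, o; simpl in *; try reflexivity; exfalso;
        try discriminate; eapply H; constructor.
  - intros ->. destruct q; simpl; try (left; constructor; fail).
    right. split; [reflexivity |]. intros F'' H. inversion H.
Qed.

(** Since every head step is forced, the process is deterministic, and its choices are those in the
    clauses of [GG]. *)
Lemma outside_in_GG (Sg : signature) (A F : formula Sg) :
  outside_in nn GG_reduction Ko A F <-> F = GG A.
Proof.
  destruct (modular_outer_GG Sg) as (_ & Hbin & Hun). split.
  - induction 1 as [a | c A B o F1 F2 H _ -> _ -> | q A o F H _ ->].
    + reflexivity.
    + apply head_step_bin in H as ->. symmetry. apply Hbin.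
    + apply head_step_un in H as ->. symmetry. apply Hun.
  - intros ->. induction A as [a | c A IHA B IHB | q A IHA].
    + exact (oi_atomic _ _ _ a).
    + rewrite Hbin. apply oi_bin; [| exact IHA | exact IHB].
      apply head_step_bin. reflexivity.
    + rewrite Hun. apply oi_un; [| exact IHA].
      apply head_step_un. reflexivity.
Qed.

(** The reductions of the general notion include identity steps for [Plus] and [Ex], so here some
    reduction matches at every stage. *)
Lemma outside_in_transforms (Sg : signature) (A : formula Sg) :
  outside_in nn (transform_reduction nn Ko_transforms GG_transforms) Ko A (GG A).
Proof.
  destruct (modular_outer_GG Sg) as (_ & Hbin & Hun).
  induction A as [a | c A IHA B IHB | q A IHA].
  - exact (oi_atomic _ _ _ a).
  - rewrite Hbin. apply oi_bin; [| exact IHA | exact IHB].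
    left. simpl. destruct (Ko_nn A) as [A' ->], (Ko_nn B) as [B' ->].
    apply (tred_bin nn Ko_transforms GG_transforms).
  - rewrite Hun. apply oi_un; [| exact IHA].
    left. simpl. destruct (Ko_nn A) as [A' ->].
    apply (tred_un nn Ko_transforms GG_transforms).
Qed.

Lemma UseId_simpler_UseT : simpler UseId UseT.
Proof.
  split; [discriminate |]. intros H. discriminate (H eq_refl).
Qed.

Lemma simpler_transforms_Ko_GG : simpler_transforms Ko_transforms GG_transforms.
Proof.
  split; [| split].
  - intros []; simpl; auto using UseId_simpler_UseT.
  - intros []; simpl; auto using UseId_simpler_UseT.
  - left. exists With. exact UseId_simpler_UseT.
Qed.

Theorem proposition7 (Sg : signature) :
  (forall A F : formula Sg, outside_in nn GG_reduction Ko A F <-> F = GG A) /\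
  simplification_from_outside (Sg := Sg) nn CL_b IL_bot Ko_transforms Ko GG_transforms GG /\
  (forall F F' : formula Sg, GG_reduction F F' -> equivalent IL_bot F F') /\
  (forall A : formula Sg, equivalent IL_bot (GG A) (Ko A)).
Proof.
  assert (HP : forall A B : formula Sg, PRO A B -> IL_bot A B) by (intros A B H; exact H).
  split; [| split; [| split]].
  - apply outside_in_GG.
  - split; [| split; [| split; [| split]]].
    + apply modular_outer_Ko.
    + apply modular_outer_GG.
    + split; [apply sound_Ko | split; [apply sound_GG |]].
      intros A. apply (equivalent_sym HP), (GG_equivalent_Ko HP).
    + apply simpler_transforms_Ko_GG.
    + apply outside_in_transforms.
  - apply (GG_reduction_reversible HP).
  - apply (GG_equivalent_Ko HP).
Qed.
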